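(* Let $q\in\mathbb{N}$ and let $W_{\text{det.async.}}$, $W_{\text{sync.}}$, $C$ be as defined in the context. Assume $I-W_{\text{sync.}}$ is non-singular and let $Y^\star=(I-W_{\text{sync.}})^{-1}C$ be the fixed point. If $Y^{k+1}=W_{\text{det.async.}}Y^k+C$ for $k\in\mathbb{N}_0$ with initial vector $Y^0$ (deterministic asynchronous algorithm), then for all $k\in\mathbb{N}_0$, $$\|Y^k-Y^\star\|_\infty=\|(W_{\text{det.async.}})^k(Y^0-Y^\star)\|_\infty\le\|(W_{\text{det.async.}})^k\|_\infty\cdot\|Y^0-Y^\star\|_\infty .$$
   Context: Distributed quadratic program: minimize $\sum_{i=1}^N\left(\frac12 x_i^\top Q_ix_i+c_i^\top x_i\right)$ subject to $\sum_{i=1}^N A_ix_i\le b$, with $Q_i\in\mathbb{R}^{n_i\times n_i}$ symmetric positive definite, $c_i\in\mathbb{R}^{n_i}$, $A_i\in\mathbb{R}^{p\times n_i}$, $b\in\mathbb{R}^p$, and constant step sizes $\alpha_i$. Define $$\Phi_i:=\alpha_iA_iQ_i^{-1}A_i^\top,\qquad R:=\sum_{i=1}^N\Phi_i\in\mathbb{R}^{p\times p},\qquad B:=\sum_{i=1}^N\left(-\alpha_iA_iQ_i^{-1}c_i-\tfrac1N\alpha_ib\right)\in\mathbb{R}^p.$$ The dual variable is $y^k\in\mathbb{R}^p$, and the augmented state is $Y^k=[y^{k\top},y^{k-1\top},\ldots,y^{k-q+1\top}]^\top\in\mathbb{R}^{qp}$; $C=[B^\top,0,\ldots,0]^\top\in\mathbb{R}^{qp}$.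 Both matrices below are $q\times q$ block matrices with $p\times p$ blocks, with identity blocks in positions $(j+1,j)$, $j=1,\ldots,q-1$, and zeros elsewhere outside the first block row. $W_{\text{sync.}}$ has first block row $[I-R,0,\ldots,0]$. $W_{\text{det.async.}}$ has first block row $[I,0,\ldots,0,-R]$ (for $q=1$: $I-R$), corresponding to the update $y^{k+1}=y^k-Ry^{k-q+1}+B$ in which the oldest value in the buffer is always used. $\|\cdot\|_\infty$ denotes the vector $\infty$-norm and its induced matrix norm. *)

(* Defs.v *)
From mathcomp Require Import all_boot all_order all_algebra.
From mathcomp Require Import all_classical all_reals all_analysis.
Set Implicit Arguments.
Unset Strict Implicit.
Unset Printing Implicit Defensive.
Import Order.TTheory GRing.Theory Num.Theory.
Import numFieldNormedType.Exports.

Local Open Scope classical_set_scope.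
Local Open Scope ring_scope.

Definition sym_posdef (R : realType) (n : nat) (Q : 'M[R]_n) : Prop :=
  Q^T = Q /\ forall x : 'cV[R]_n, x != 0 -> 0 < (x^T *m Q *m x) 0 0.

(* On matrices, `|_| is the largest absolute value of an entry; it is the
   infinity norm on column vectors, but not the induced norm on matrices. *)
Definition ind_norm_inf (R : realType) (m n : nat) (A : 'M[R]_(m, n)) : R :=
  sup [set `|A *m v| / `|v| | v in [set v : 'cV[R]_n | v != 0]].

(* The dimension q * p of the augmented state, in the form required by the
   block matrix operations \mxblock and \mxcol. *)
Notation aug_dim q p := (\sum_(i < q) p)%N.

Section DualIteration.
Variables (R : realType) (N p : nat) (n : 'I_N -> nat).
Variables (Q : forall i, 'M[R]_(n i)) (c : forall i, 'cV[R]_(n i)).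
Variables (A : forall i, 'M[R]_(p, n i)) (b : 'cV[R]_p) (alpha : 'I_N -> R).

Definition Phi (i : 'I_N) : 'M[R]_p :=
  alpha i *: (A i *m invmx (Q i) *m (A i)^T).

Definition Rmx : 'M[R]_p := \sum_(i < N) Phi i.

Definition Bvec : 'cV[R]_p :=
  \sum_(i < N) (- (alpha i *: (A i *m invmx (Q i) *m c i))
                - (N%:R^-1 * alpha i) *: b).

Variable q : nat.

Definition Cvec : 'cV[R]_(aug_dim q p) :=
  \mxcol_(i < q) (if val i == 0 then Bvec else 0).

Definition Wsync : 'M[R]_(aug_dim q p) :=
  \mxblock_(i < q, j < q)
    (if val i == 0 then (if val j == 0 then 1%:M - Rmx else 0)
     else if val i == (val j).+1 then 1%:M else 0).

(* When q = 1 the two contributions to the first block row fall in the same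
   block, which is then 1%:M - Rmx. *)
Definition Wasync : 'M[R]_(aug_dim q p) :=
  \mxblock_(i < q, j < q)
    (if val i == 0 then (if val j == 0 then 1%:M else 0)
                        - (if (val j).+1 == q then Rmx else 0)
     else if val i == (val j).+1 then 1%:M else 0).

Definition Ystar : 'cV[R]_(aug_dim q p) := invmx (1%:M - Wsync) *m Cvec.

End DualIteration.

(* Main.v *)
(** All blocks of a fixed point of the synchronous iteration coincide, because of
the identity blocks below the diagonal.  On states with equal blocks only the
sums of the blocks in each block row of the iteration matrix matter, and these
sums are the same for the synchronous and the asynchronous matrix.  Hence
[Ystar] is also a fixed point of the asynchronous affine map, and the error is
multiplied by [Wasync] at every step. *)

Require Import Defs.
From mathcomp Require Import all_boot all_order all_algebra.
From mathcomp Require Import all_classical all_reals all_analysis.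
Set Implicit Arguments.
Unset Strict Implicit.
Unset Printing Implicit Defensive.
Import Order.TTheory GRing.Theory Num.Theory.
Import numFieldNormedType.Exports.
Local Open Scope ring_scope.

(** A crude bound, each entry of the product being a sum of [n] terms. It serves to bound the
    quotients in [ind_norm_inf] from above. *)
Lemma normr_mulmx_le (R : realType) (m n : nat) (M : 'M[R]_(m, n))
  (v : 'cV[R]_n) : `|M *m v| <= (n%:R * `|M|) * `|v|.
Proof.
have entry_le k l (B : 'M[R]_(k, l)) i j : `|B i j| <= `|B|.
  by rewrite [leRHS]/Num.norm /= mx_normrE; exact: (le_bigmax _ _ (i, j)).
rewrite [leLHS]/Num.norm /= mx_normrE; apply: bigmax_le => [|[i j] _ /=].
  by rewrite !mulr_ge0.
rewrite mxE (le_trans (ler_norm_sum _ _ _))//.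
rewrite -mulrA mulr_natl -[X in _ *+ X](card_ord n) -sumr_const.
by apply: ler_sum => k _; rewrite normrM ler_pM.
Qed.

(* Without the upper bound on the quotients, [sup] would be the junk value 0. *)
Lemma normr_mulmx_ind_norm (R : realType) (m n : nat) (M : 'M[R]_(m, n))
  (v : 'cV[R]_n) : `|M *m v| <= ind_norm_inf M * `|v|.
Proof.
have [->|v0] := eqVneq v 0; first by rewrite mulmx0 !normr0 mulr0.
rewrite -ler_pdivrMr ?normr_gt0//; apply: ub_le_sup; last by exists v.
exists (n%:R * `|M|) => _ [w /= w0 <-].
by rewrite ler_pdivrMr ?normr_gt0// normr_mulmx_le.
Qed.

Section FixedPoint.
Variables (R : realType) (N p : nat) (n : 'I_N -> nat).
Variables (Q : forall i, 'M[R]_(n i)) (c : forall i, 'cV[R]_(n i)).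
Variables (A : forall i, 'M[R]_(p, n i)) (b : 'cV[R]_p) (alpha : 'I_N -> R).
Variable q : nat.

Local Notation Ws := (Wsync Q A alpha q.+1).
Local Notation Wa := (Wasync Q A alpha q.+1).
Local Notation C := (Cvec Q c A b alpha q.+1).

(** By induction on [i]: since [C] vanishes below its first block, block row [k.+1] of the equation
    equates block [k.+1] of [V] with block [k]. *)
Lemma sync_fixed_blocks (V : 'cV[R]_(aug_dim q.+1 p)) (i : 'I_q.+1) :
  Ws *m V + C = V -> submxcol V i = submxcol V ord0.
Proof.
move=> fixV; case: i; elim=> [|k IH] lt_kq; first by congr submxcol; exact/val_inj.
rewrite -(IH (ltnW lt_kq)) -[in LHS]fixV -[V in Ws *m V]submxcolK.
rewrite /Wsync mul_mxblock_mxrow submxcolD !mxcolK /= addr0.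
rewrite (bigD1 (Ordinal (ltnW lt_kq))) //= eqxx mul1mx big1 ?addr0 // => j.
by rewrite -val_eqE /= eqSS eq_sym => /negPf ->; rewrite mul0mx.
Qed.

Lemma sync_async_const_blocks (y : 'cV[R]_p) :
  Wa *m \mxcol_(i < q.+1) y = Ws *m \mxcol_(i < q.+1) y.
Proof.
rewrite /Wasync /Wsync !mul_mxblock_mxrow; apply: eq_mxcol => i.
(* Factoring out [y] leaves the block row sums. They need comparing only in the first row, where
   both equal [1%:M - Rmx]. *)
rewrite -!mulmx_suml; congr (_ *m _); have [i0|//] := eqVneq (val i) 0%N.
rewrite sumrB -!big_mkcond /= (big_pred1 ord0); last by move=> j /=; rewrite -val_eqE.
rewrite (big_pred1 ord_max); last by move=> j /=; rewrite eqSS -val_eqE.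
by rewrite (big_pred1 ord0) // => j /=; rewrite -val_eqE.
Qed.

Lemma sync_fixed_async_fixed (V : 'cV[R]_(aug_dim q.+1 p)) :
  Ws *m V + C = V -> Wa *m V + C = V.
Proof.
move=> fixV; rewrite -[RHS]fixV; congr (_ + _).
have -> : V = \mxcol_(i < q.+1) submxcol V ord0.
  by rewrite -[LHS]submxcolK; apply: eq_mxcol => i; exact: sync_fixed_blocks.
exact: sync_async_const_blocks.
Qed.

End FixedPoint.

Lemma affine_iter_error (R : pzRingType) (m : nat) (W : 'M[R]_m)
  (C Z : 'cV[R]_m) (Y : nat -> 'cV[R]_m) :
  W *m Z + C = Z -> (forall k, Y k.+1 = W *m Y k + C) ->
  forall k, Y k - Z = W ^+ k *m (Y 0%N - Z).
Proof.
move=> fixZ Y_rec; elim=> [|k IH]; first by rewrite expr0 mul1mx.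
(* Writing [Z] as [W *m Z + C] makes [C] cancel in the difference. *)
rewrite exprS -mulmxE -mulmxA -IH Y_rec -[in LHS]fixZ.
by rewrite mulmxBr opprD addrACA subrr addr0.
Qed.

Theorem mainTheorem4 (R : realType) (N p : nat) (n : 'I_N -> nat)
  (Q : forall i, 'M[R]_(n i)) (c : forall i, 'cV[R]_(n i))
  (A : forall i, 'M[R]_(p, n i)) (b : 'cV[R]_p) (alpha : 'I_N -> R)
  (q : nat) (Y : nat -> 'cV[R]_(aug_dim q p))
  (N_gt0 : (0 < N)%N) (p_gt0 : (0 < p)%N) (n_gt0 : forall i, (0 < n i)%N)
  (q_gt0 : (0 < q)%N)
  (Q_posdef : forall i, sym_posdef (Q i))
  (sync_nonsing : 1%:M - Wsync Q A alpha q \in unitmx)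
  (Y_rec : forall k, Y k.+1 = Wasync Q A alpha q *m Y k
                              + Cvec Q c A b alpha q) :
  forall k : nat,
    `|Y k - Ystar Q c A b alpha q|
      = `|Wasync Q A alpha q ^+ k *m (Y 0%N - Ystar Q c A b alpha q)|
    /\ `|Wasync Q A alpha q ^+ k *m (Y 0%N - Ystar Q c A b alpha q)|
      <= ind_norm_inf (Wasync Q A alpha q ^+ k)
         * `|Y 0%N - Ystar Q c A b alpha q|.
Proof.
move=> k; split; last exact: normr_mulmx_ind_norm.
congr (`| _ |); apply: (@affine_iter_error _ _ _ (Cvec Q c A b alpha q)) => //.
(* Nonsingularity enters here: [Ystar] solves the linear system with matrix [1%:M - Wsync] and
   right-hand side [Cvec]. *)
have sync_fix : Wsync Q A alpha q *m Ystar Q c A b alpha q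
    + Cvec Q c A b alpha q = Ystar Q c A b alpha q.
  apply/esym/eqP; rewrite addrC -subr_eq -[X in X - _]mul1mx -mulmxBl.
  by rewrite mulKVmx.
(* A positive [q] is a successor, so the blocks [ord0] and [ord_max] exist. *)
case: q q_gt0 {Y Y_rec sync_nonsing} sync_fix => // q' _.
exact: sync_fixed_async_fixed.
Qed.
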